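(* Let $F=F_1\times\dots\times F_d$, where each $F_i$ is a closed subset of $[0,1]$ containing $0$ and $1$, and let $f:F\to\mathbb{R}$ be continuous. Then there exists a unique continuous function $g$ on $[0,1]^d$, equal to $f$ on $F$, such that for all $i=1,\dots,d$ and all $t\in[0,1]^d$, the univariate cut function $u_i\mapsto g(u_i,t_{\sim i})$ is affine on each interval of $[0,1]\setminus F_i$. Furthermore, $g$ is obtained sequentially from $f$ by linearly extending univariate cuts: $$g=L_1\cdots L_d\,f,$$ where $L_i$ maps a function $h:F_1\times\dots\times F_i\times[0,1]^{d-i}\to\mathbb{R}$ to the function on $F_1\times\dots\times F_{i-1}\times[0,1]^{d-i+1}$ given by $L_ih(t)=(L_{F_i}[h(\cdot,t_{\sim i})])(t_i)$. Furthermore, denoting $g=P_{F\to[0,1]^d}(f)$ (the multiaffine extension of $f$), we have for all $t\in[0,1]^d$ $$P_{F\to[0,1]^d}(f)(t)=\sum_{\epsilon_1,\dots,\epsilon_d\in\{-,+\}}\Big(\prod_{j=1}^d\omega_{\epsilon_j}(t_j)\Big)f(t_1^{\epsilon_1},\dots,t_d^{\epsilon_d}),$$ where the $2^d$ products are non-negative and sum to one.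
   Context: For $t\in[0,1]^d$, $t_{\sim i}$ is $t$ with coordinate $i$ removed, and $(u_i,t_{\sim i})$ is $t$ with $i$-th coordinate replaced by $u_i$. For a closed $B\subseteq[0,1]$ containing $0$ and $1$ and $t\in[0,1]$, let $t^-=\max\{u\in B:u\le t\}$ and $t^+=\min\{u\in B:u\ge t\}$. If $t\notin B$, $\omega_+(t)=\frac{t-t^-}{t^+-t^-}$ and $\omega_-(t)=1-\omega_+(t)$; if $t\in B$ (so $t^-=t^+=t$), $\omega_+(t)=\omega_-(t)=\frac12$. For $g:B\to\mathbb{R}$, the affine extension $L_Bg:[0,1]\to\mathbb{R}$ is $L_Bg(t)=g(t)$ if $t\in B$ and $L_Bg(t)=\omega_-(t)g(t^-)+\omega_+(t)g(t^+)$ if $t\notin B$. In the displayed formula, $t_j^{\pm}$ and $\omega_\pm(t_j)$ are relative to $B=F_j$. *)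

(* Defs.v *)
From HB Require Import structures.
From mathcomp Require Import all_boot all_order all_algebra.
From mathcomp Require Import all_classical all_reals all_analysis.

Set Implicit Arguments.
Unset Strict Implicit.
Unset Printing Implicit Defensive.

Import Order.TTheory GRing.Theory Num.Theory.
Import numFieldNormedType.Exports.

Local Open Scope classical_set_scope.
Local Open Scope ring_scope.

Section Univariate.
Variable R : realType.
Implicit Types (A B : set R) (t : R) (s : bool).

(* The maximum and minimum are genuine (they belong to A); the default value 0
   is only used when A has none, which does not happen in [nearest B s t] for
   B closed in [0, 1] with 0, 1 in B, and t in [0, 1]. *)
Definition set_max A : R := xget 0 (A `&` ubound A).
Definition set_min A : R := xget 0 (A `&` lbound A).

(* Signs are booleans: [true] stands for + and [false] for -. *)
Definition nearest B s t : R :=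
  if s then set_min [set u | B u /\ t <= u]
  else set_max [set u | B u /\ u <= t].

Definition weight B s t : R :=
  if t \in B then 2^-1
  else let wplus := (t - nearest B false t) /
                    (nearest B true t - nearest B false t) in
       if s then wplus else 1 - wplus.

Definition affine_ext B (g : R -> R) t : R :=
  if t \in B then g t
  else weight B false t * g (nearest B false t)
     + weight B true t * g (nearest B true t).

Definition affine_on A (h : R -> R) : Prop :=
  exists a b : R, forall u, A u -> h u = a * u + b.

End Univariate.

Section Multivariate.
Variables (R : realType) (d : nat).
Implicit Types (F : 'I_d -> set R) (t : 'rV[R]_d) (i : 'I_d).

Definition box F : set 'rV[R]_d := [set t | forall i, F i (t 0 i)].

Definition cube : set 'rV[R]_d := box (fun=> `[0, 1]%classic).

Definition set_coord t i (u : R) : 'rV[R]_d :=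
  \row_j (if j == i then u else t 0 j).

Definition cut (g : 'rV[R]_d -> R) i t : R -> R := fun u => g (set_coord t i u).

(* Functions on a subset of R^d are total functions whose values outside of
   that subset are irrelevant: for t in F_1 x .. x F_(i-1) x [0,1]^(d-i+1),
   [extend_coord F i h t] only depends on the values of h on
   F_1 x .. x F_i x [0,1]^(d-i). *)
Definition extend_coord F i (h : 'rV[R]_d -> R) : 'rV[R]_d -> R :=
  fun t => affine_ext (F i) (cut h i t) (t 0 i).

(* L_1 (L_2 (.. (L_d f))) *)
Definition sequential_ext F (f : 'rV[R]_d -> R) : 'rV[R]_d -> R :=
  foldr (extend_coord F) f (enum 'I_d).

(* The intervals I below need not be maximal; restricting an affine function
   to a smaller interval, this is the same as requiring it of the maximal
   intervals contained in [0, 1] minus F_i. *)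
Definition multiaffine_extension F (f g : 'rV[R]_d -> R) : Prop :=
  [/\ {within cube, continuous g},
      forall t, box F t -> g t = f t
    & forall i t, cube t -> forall I : set R,
        is_interval I -> I `<=` `[0, 1]%classic `\` F i ->
        affine_on I (cut g i t)].

Definition corner F (eps : {ffun 'I_d -> bool}) t : 'rV[R]_d :=
  \row_j nearest (F j) (eps j) (t 0 j).

Definition corner_weight F (eps : {ffun 'I_d -> bool}) t : R :=
  \prod_(j < d) weight (F j) (eps j) (t 0 j).

End Multivariate.

Arguments cube {R d}.

(* Main.v *)
Require Import Defs.
From HB Require Import structures.
From mathcomp Require Import all_boot all_order all_algebra.
From mathcomp Require Import all_classical all_reals all_analysis.
From mathcomp Require Import ring lra.

Import Order.TTheory GRing.Theory Num.Theory.
Import numFieldNormedType.Exports.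

Local Open Scope classical_set_scope.
Local Open Scope ring_scope.

(** Extending affinely in one coordinate replaces the value at t by the mean,
    with the weights of t, of the values at the two nearest knots of t. It is
    thus a positive linear operator that fixes the affine functions; the rest
    of the proof uses little more than this.

    Continuity of the extension is the delicate point, because the nearest
    knots and the weights are not continuous in t where knots accumulate. It is
    obtained from a uniform estimate which avoids any case analysis on the local
    structure of the F_i. On a compact set, a function f is continuous if and
    only if for every e > 0 there is a K with
      |f x - f y| <= e + K * |x - y|_1
    for all x and y ([continuous_almost_lipschitz],
    [almost_lipschitz_continuous]). Extending in one coordinate preserves this
    condition, up to replacing e by 3 e and K by 2 K
    ([extend_coord_almost_lipschitz]): in dimension one, if p is a knot, then
    both nearest knots of t are on the same side of p, so that the mean of
    e + K * |u - p| over them is exactly e + K * |t - p|, which bounds the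
    distance from the extension at t to the value at p
    ([affine_ext_dist_knot]). Two points separated by a knot are compared
    through that knot, and two points of one gap by the slope of the extension
    on this gap ([affine_ext_dist]).

    Uniqueness and the corner formula are the same statement. Extending f in the
    coordinates i_1, ..., i_k gives a function on the box where these coordinates
    run over [0, 1] and the other ones over their F_i. By induction on k, it
    agrees there with any g that extends f and is fixed, on the cube, by the
    affine extension in each coordinate ([extend_coords_fixed]). A multiaffine
    extension is fixed because a continuous function on a closed gap that is
    affine inside is the interpolation of its end values ([affine_gap_ext]). The
    sum over corners is fixed too ([extend_coord_corner_sum]): extending it in
    coordinate i puts knots at this coordinate, where both weights are 1/2 and
    the sign is irrelevant, so that every corner appears twice with half of its
    weight. *)

Set Implicit Arguments.
Unset Strict Implicit.
Unset Printing Implicit Defensive.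

(** * Affine extension in one variable *)

Arguments nearest : simpl never.

Definition knots (R : realType) (B : set R) : Prop :=
  [/\ closed B, B `<=` `[0, 1]%classic, B 0 & B 1].

Lemma set_maxP (R : realType) (A : set R) : compact A -> A !=set0 ->
  A (set_max A) /\ ubound A (set_max A).
Proof.
move=> cA A0; apply: (@xgetPex _ 0 (A `&` ubound A)).
have [|c /set_mem Ac cub] := @compact_EVT_max _ R idfun A A0 cA.
  by apply: continuous_subspaceT => x; exact: cvg_id.
by exists c; split=> // u Au; apply: cub; exact: mem_set.
Qed.

Lemma set_minP (R : realType) (A : set R) : compact A -> A !=set0 ->
  A (set_min A) /\ lbound A (set_min A).
Proof.
move=> cA A0; apply: (@xgetPex _ 0 (A `&` lbound A)).
have [|c /set_mem Ac clb] := @compact_EVT_min _ R idfun A A0 cA.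
  by apply: continuous_subspaceT => x; exact: cvg_id.
by exists c; split=> // u Au; apply: clb; exact: mem_set.
Qed.

Section OneCoordinate.
Context (R : realType) (B : set R) (B_knots : knots B).
Implicit Types (g h : R -> R) (p t u v : R) (s : bool).

Lemma knots_compact : compact B.
Proof.
have [cB sB _ _] := B_knots.
exact: subclosed_compact cB (@segment_compact R 0 1) sB.
Qed.

Lemma nearest_falseP t : 0 <= t ->
  [/\ B (nearest B false t), nearest B false t <= t
    & forall u, B u -> u <= t -> u <= nearest B false t].
Proof.
move=> t0; have [_ _ B0 _] := B_knots.
have [||[Bm mt] mub] := @set_maxP R [set u | B u /\ u <= t].
- apply: (subclosed_compact _ knots_compact); last by move=> u [].
  apply: closedI; [by case: B_knots | exact: closed_le].
- by exists 0.
- by split=> // u Bu ut; apply: mub.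
Qed.

Lemma nearest_trueP t : t <= 1 ->
  [/\ B (nearest B true t), t <= nearest B true t
    & forall u, B u -> t <= u -> nearest B true t <= u].
Proof.
move=> t1; have [_ _ _ B1] := B_knots.
have [||[Bm mt] mlb] := @set_minP R [set u | B u /\ t <= u].
- apply: (subclosed_compact _ knots_compact); last by move=> u [].
  apply: closedI; [by case: B_knots | exact: closed_ge].
- by exists 1.
- by split=> // u Bu ut; apply: mlb.
Qed.

Lemma nearest_knot s t : 0 <= t <= 1 -> B (nearest B s t).
Proof.
by move=> /andP[t0 t1]; case: s;
  [case: (nearest_trueP t1) | case: (nearest_falseP t0)].
Qed.

Lemma knots01 u : B u -> 0 <= u <= 1.
Proof. by case: B_knots => _ sB _ _ /sB/=; rewrite in_itv. Qed.

Lemma nearest_id s t : B t -> nearest B s t = t.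
Proof.
move=> Bt; have /andP[t0 t1] := knots01 Bt; case: s.
- have [_ le_t min_t] := nearest_trueP t1.
  by apply/eqP; rewrite eq_le le_t min_t.
- have [_ ge_t max_t] := nearest_falseP t0.
  by apply/eqP; rewrite eq_le ge_t max_t.
Qed.

Lemma nearest_gap t : 0 <= t <= 1 -> ~ B t ->
  nearest B false t < t < nearest B true t.
Proof.
move=> /andP[t0 t1] Bt.
have [Bm mt _] := nearest_falseP t0; have [Bp tp _] := nearest_trueP t1.
by rewrite !lt_neqAle mt tp !andbT; apply/andP; split; apply/eqP => E;
  apply: Bt; [rewrite -E | rewrite E].
Qed.

(** No knot separates two points of an interval that avoids B: a nearest knot
    of one of them that were not beyond the other one would lie between them,
    hence in the interval. *)
Lemma nearest_eq s (I : set R) t v :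
  is_interval I -> I `<=` `[0, 1]%classic `\` B -> I t -> I v ->
  nearest B s t = nearest B s v.
Proof.
move=> itvI sI.
suff le_nearest x y : I x -> I y -> nearest B s x <= nearest B s y.
  by move=> It Iv; apply/eqP; rewrite eq_le !le_nearest.
move=> Ix Iy.
have [/= + Bx] := sI _ Ix; rewrite in_itv /= => /andP[x0 x1].
have [/= + By] := sI _ Iy; rewrite in_itv /= => /andP[y0 y1].
have [Bmx mx _] := nearest_falseP x0; have [_ _ minx] := nearest_trueP x1.
have [_ _ maxy] := nearest_falseP y0; have [Bpy py _] := nearest_trueP y1.
case: s.
- apply: minx => //; rewrite leNgt; apply/negP => lt_x.
  by case: (sI (nearest B true y)) => //; apply: (itvI y x) => //; rewrite py ltW.
- apply: maxy => //; rewrite leNgt; apply/negP => lt_y.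
  by case: (sI (nearest B false x)) => //; apply: (itvI y x) => //; rewrite mx ltW.
Qed.

Lemma weight_knot s t : B t -> weight B s t = 2^-1.
Proof. by move=> Bt; rewrite /weight mem_set. Qed.

Lemma weight_gap s t : ~ B t -> weight B s t =
  let wplus := (t - nearest B false t) /
               (nearest B true t - nearest B false t) in
  if s then wplus else 1 - wplus.
Proof. by move=> Bt; rewrite /weight memNset. Qed.

Lemma sum_weight t : \sum_(s : bool) weight B s t = 1.
Proof.
rewrite big_bool /=; have [Bt|Bt] := pselect (B t).
  by rewrite !weight_knot//; lra.
by rewrite !weight_gap//= addrC subrK.
Qed.

Lemma weight_ge0 s t : 0 <= t <= 1 -> 0 <= weight B s t.
Proof.
move=> t01; have [Bt|Bt] := pselect (B t).
  by rewrite weight_knot// invr_ge0.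
rewrite weight_gap//=; have /andP[mt tp] := nearest_gap t01 Bt.
case: s; first by apply: divr_ge0; lra.
by rewrite subr_ge0 ler_pdivrMr; lra.
Qed.

(** The mean formula also covers the knots, where it averages two equal
    values. *)
Lemma affine_extE g t :
  affine_ext B g t = \sum_(s : bool) weight B s t * g (nearest B s t).
Proof.
rewrite big_bool /= /affine_ext; case: ifPn => [/set_mem Bt|_]; last exact: addrC.
by rewrite !weight_knot// !nearest_id//; lra.
Qed.

Lemma affine_ext_knot g t : B t -> affine_ext B g t = g t.
Proof. by move=> Bt; rewrite /affine_ext mem_set. Qed.

Lemma affine_ext_gap g t : 0 <= t <= 1 -> ~ B t ->
  let m := nearest B false t in let p := nearest B true t in
  affine_ext B g t = (g p - g m) / (p - m) * (t - m) + g m.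
Proof.
move=> t01 Bt m p; rewrite affine_extE big_bool /= !weight_gap//=.
by have := nearest_gap t01 Bt; rewrite -/m -/p => /andP[? ?]; field; lra.
Qed.

Lemma affine_ext_affine (a b t : R) : 0 <= t <= 1 ->
  affine_ext B (fun u => a * u + b) t = a * t + b.
Proof.
move=> t01; have [Bt|Bt] := pselect (B t); first exact: affine_ext_knot.
rewrite affine_ext_gap//=; have /andP[? ?] := nearest_gap t01 Bt.
by field; lra.
Qed.

Lemma affine_ext_const (c : R) t : affine_ext B (fun=> c) t = c.
Proof. by rewrite affine_extE -mulr_suml sum_weight mul1r. Qed.

Lemma affine_extB g h t :
  affine_ext B g t - affine_ext B h t = affine_ext B (fun u => g u - h u) t.
Proof.
by rewrite !affine_extE -sumrB; apply: eq_bigr => s _; rewrite mulrBr.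
Qed.

Lemma affine_ext_eq g h t : 0 <= t <= 1 -> (forall u, B u -> g u = h u) ->
  affine_ext B g t = affine_ext B h t.
Proof.
move=> t01 gh; rewrite !affine_extE; apply: eq_bigr => s _.
by rewrite gh//; exact: nearest_knot.
Qed.

Lemma normr_affine_ext g h t : 0 <= t <= 1 ->
  (forall s, `|g (nearest B s t)| <= h (nearest B s t)) ->
  `|affine_ext B g t| <= affine_ext B h t.
Proof.
move=> t01 gh; rewrite !affine_extE.
apply: le_trans (ler_norm_sum _ _ _) _; apply: ler_sum => s _.
by rewrite normrM ger0_norm ?weight_ge0// ler_wpM2l// weight_ge0.
Qed.

Lemma affine_ext_affine_on g (I : set R) : is_interval I ->
  I `<=` `[0, 1]%classic `\` B -> affine_on I (affine_ext B g).
Proof.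
move=> itvI sI; have [[c Ic]|I0] := pselect (I !=set0); last first.
  by exists 0, 0 => u Iu; case: I0; exists u.
set m := nearest B false c; set p := nearest B true c.
exists ((g p - g m) / (p - m)), (g m - (g p - g m) / (p - m) * m) => u Iu.
have [/= + Bu] := sI _ Iu; rewrite in_itv /= => u01.
rewrite affine_ext_gap// !(@nearest_eq _ I u c)//; rewrite -/m -/p; ring.
Qed.

(** The bound e + K * |u - p| is affine in u on either side of p, and both
    nearest knots of t lie on the same side of the knot p as t; extending the
    bound affinely therefore gives its value at t. *)
Lemma affine_ext_dist_knot g (e K : R) t p :
  (forall u v, B u -> B v -> `|g u - g v| <= e + K * `|u - v|) ->
  0 <= t <= 1 -> B p -> `|affine_ext B g t - g p| <= e + K * `|t - p|.
Proof.
move=> gK t01 Bp; have /andP[t0 t1] := t01.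
rewrite -{1}(affine_ext_const (g p) t) affine_extB.
have [Bm mt maxt] := nearest_falseP t0; have [Bq tq mint] := nearest_trueP t1.
have [pt|tp] := leP p t.
- have -> : e + K * `|t - p| = affine_ext B (fun u => K * u + (e - K * p)) t.
    by rewrite affine_ext_affine// ger0_norm ?subr_ge0//; ring.
  apply: normr_affine_ext => // s.
  apply: le_trans (gK _ _ (nearest_knot s t01) Bp) _.
  rewrite ger0_norm; first lra.
  rewrite subr_ge0; case: s; [exact: le_trans tq | exact: maxt].
- have -> : e + K * `|t - p| = affine_ext B (fun u => - K * u + (e + K * p)) t.
    by rewrite affine_ext_affine// ltr0_norm ?subr_lt0//; ring.
  apply: normr_affine_ext => // s.
  apply: le_trans (gK _ _ (nearest_knot s t01) Bp) _.
  rewrite ler0_norm; first lra.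
  rewrite subr_le0; case: s; [apply: mint => //; exact: ltW |].
  exact/ltW/(le_lt_trans mt).
Qed.

(** Comparing t and v through a knot that separates them costs e twice. Inside a
    gap of length l the slope is at most (e + K * l) / l, and |t - v| <= l turns
    the term e / l * |t - v| into at most e. *)
Lemma affine_ext_dist g (e K : R) t v : 0 <= e -> 0 <= K ->
  (forall u w, B u -> B w -> `|g u - g w| <= e + K * `|u - w|) ->
  0 <= t <= 1 -> 0 <= v <= 1 ->
  `|affine_ext B g t - affine_ext B g v| <= e *+ 2 + K * `|t - v|.
Proof.
move=> e0 K0 gK; wlog tv : t v / t <= v.
  move=> H t01 v01; have [tv|/ltW vt] := leP t v; first exact: H.
  by rewrite distrC (distrC t); exact: H.
move=> t01 v01; have /andP[t0 t1] := t01; have /andP[v0 v1] := v01.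
have [[p [Bp /andP[tp pv]]]|noB] := pselect (exists p, B p /\ t <= p <= v).
  apply: le_trans (ler_distD (g p) _ _) _; rewrite (distrC (g p)).
  apply: le_trans (lerD (affine_ext_dist_knot gK t01 Bp)
                        (affine_ext_dist_knot gK v01 Bp)) _.
  rewrite (distrC t p) (distrC t v).
  by rewrite (ger0_norm (_ : 0 <= p - t)) ?(ger0_norm (_ : 0 <= v - p))
             ?(ger0_norm (_ : 0 <= v - t)) ?subr_ge0//; lra.
have tvI : `[t, v]%classic `<=` `[0, 1]%classic `\` B.
  move=> u; rewrite /= !in_itv /= => /andP[tu uv]; split.
    by rewrite (le_trans t0)//= (le_trans uv).
  by move=> Bu; apply: noB; exists u; rewrite tu.
have [Bt Bv] : ~ B t /\ ~ B v.
  by split; [case: (tvI t) | case: (tvI v)] => //=; rewrite in_itv /= lexx tv.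
rewrite !affine_ext_gap//.
have ntv s : nearest B s v = nearest B s t.
  apply: (@nearest_eq s `[t, v]%classic) => //; first exact: interval_is_interval.
    by rewrite /= in_itv /= lexx tv.
  by rewrite /= in_itv /= lexx tv.
have /andP[mt tp] := nearest_gap t01 Bt.
have /andP[_] := nearest_gap v01 Bv; rewrite !ntv.
set m := nearest B false t; set p := nearest B true t => vp.
have := gK p m (nearest_knot true t01) (nearest_knot false t01).
have mp : 0 < p - m by rewrite subr_gt0; exact: lt_trans mt tp.
rewrite (gtr0_norm mp) => slope.
rewrite (_ : _ - _ = (g p - g m) / (p - m) * (t - v)); last ring.
rewrite normrM normrM normfV (gtr0_norm mp).
apply: (@le_trans _ _ ((e + K * (p - m)) / (p - m) * `|t - v|)).
  by rewrite ler_wpM2r// ler_wpM2r// invr_ge0 ltW.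
have le1 : `|t - v| / (p - m) <= 1.
  rewrite ler_pdivrMr// mul1r distrC ger0_norm ?subr_ge0//.
  by move: mt tp vp; rewrite -/m -/p; lra.
rewrite (_ : _ * `|t - v| = e * (`|t - v| / (p - m)) + K * `|t - v|); last by field; lra.
rewrite lerD2r mulr2n -[leLHS]addr0 lerD// -[leRHS]mulr1 ler_wpM2l//.
Qed.

(** By continuity, the affine formula valid on the open gap around t persists at
    its two end knots, so h interpolates its values there. *)
Lemma affine_gap_ext h t : {within `[0, 1], continuous h} ->
  (forall I : set R, is_interval I -> I `<=` `[0, 1]%classic `\` B ->
     affine_on I h) ->
  0 <= t <= 1 -> affine_ext B h t = h t.
Proof.
move=> ch ah t01; have [Bt|Bt] := pselect (B t); first exact: affine_ext_knot.
have /andP[t0 t1] := t01.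
have /andP[mt tp] := nearest_gap t01 Bt.
have [Bm _ maxm] := nearest_falseP t0; have [Bp _ minp] := nearest_trueP t1.
rewrite affine_ext_gap//; set m := nearest B false t; set p := nearest B true t.
rewrite -/m -/p in mt tp Bm Bp maxm minp.
have /andP[m0 _] := knots01 Bm; have /andP[_ p1] := knots01 Bp.
have [|a [b hab]] := ah `]m, p[%classic (@interval_is_interval _ _).
  move=> u; rewrite /= !in_itv /= => /andP[mu up]; split.
    by rewrite (le_trans m0 (ltW mu)) (le_trans (ltW up) p1).
  move=> Bu; have [ut|/ltW tu] := leP u t.
    by have := maxm _ Bu ut; rewrite leNgt mu.
  by have := minp _ Bu tu; rewrite leNgt up.
have mp : m < p := lt_trans mt tp.
have : {within `[m, p], continuous h}.
  apply: continuous_subspaceW ch => u; rewrite /= !in_itv /= => /andP[mu up].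
  by rewrite (le_trans m0 mu) (le_trans up p1).
have cab : continuous (fun u : R => a * u + b).
  move=> u; apply: cvgD; last exact: cvg_cst.
  by apply: cvgMr; exact: cvg_id.
move=> /(continuous_within_itvP _ mp)[_ hm hp].
have -> : h m = a * m + b.
  apply: (cvg_unique _ hm) => //.
  apply: (@cvg_trans _ ((fun u => a * u + b) @ m^'+)); last exact: cvg_at_right_filter (cab m).
  apply: near_eq_cvg; near=> u; apply/esym/hab.
  by rewrite /= in_itv /=; apply/andP; split; near: u;
     [exact: nbhs_right_gt | exact: nbhs_right_lt].
have -> : h p = a * p + b.
  apply: (cvg_unique _ hp) => //.
  apply: (@cvg_trans _ ((fun u => a * u + b) @ p^'-)); last exact: cvg_at_left_filter (cab p).
  apply: near_eq_cvg; near=> u; apply/esym/hab.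
  by rewrite /= in_itv /=; apply/andP; split; near: u;
     [exact: nbhs_left_gt | exact: nbhs_left_lt].
rewrite hab; last by rewrite /= in_itv /= mt.
by field; lra.
Unshelve. all: by end_near. Qed.

End OneCoordinate.
(** * Uniform continuity with an affine modulus *)

Section AlmostLipschitz.
Context (R : realType) (d : nat).
Implicit Types (A : set 'rV[R]_d) (h : 'rV[R]_d -> R) (x y t : 'rV[R]_d).

Definition l1dist x y : R := \sum_j `|x 0 j - y 0 j|.

(** For bounded functions this is uniform continuity, written with moduli
    e + K * r that affine extension transforms in a controlled way. *)
Definition almost_lipschitz A h : Prop :=
  forall e : R, 0 < e -> exists2 K : R, 0 <= K &
    forall x y, A x -> A y -> `|h x - h y| <= e + K * l1dist x y.

Lemma l1dist_ge0 x y : 0 <= l1dist x y.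
Proof. exact: sumr_ge0. Qed.

Lemma le_coord_l1dist x y i : `|x 0 i - y 0 i| <= l1dist x y.
Proof. by rewrite /l1dist (bigD1 i)//= lerDl sumr_ge0. Qed.

Lemma l1dist_ball x y (r : R) : l1dist x y < r -> ball x r y.
Proof.
move=> xyr; split; first exact: le_lt_trans (l1dist_ge0 _ _) xyr.
by move=> i j; rewrite (ord1 i); exact: le_lt_trans (le_coord_l1dist _ _ _) xyr.
Qed.

Lemma ball_l1dist x y (r : R) : ball x r y -> l1dist x y <= r *+ d.
Proof.
move=> [_ xyr]; rewrite -[X in _ *+ X]card_ord -sumr_const.
by apply: ler_sum => i _; exact/ltW/xyr.
Qed.

(** Near x, either y is close enough for continuity at x to give the bound e, or
    y is at distance at least r / 2 and a large K makes K * r / 2 exceed twice a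
    bound on h. Compactness makes K uniform in x. *)
Lemma continuous_almost_lipschitz A h :
  compact A -> {within A, continuous h} -> almost_lipschitz A h.
Proof.
move=> cA ch e e0.
have [M [M0 hM]] : exists M : R, 0 < M /\ forall x, A x -> `|h x| <= M.
  have [M [_ hM]] := compact_bounded (continuous_compact ch cA).
  exists (`|M| + 1); split; first by rewrite ltr_pwDr.
  move=> x Ax; apply: (hM (`|M| + 1)); last by exists x.
  by rewrite (le_lt_trans (ler_norm M))// ltrDl.
have [K [_ hK]] : \forall K \near +oo%R, A `<=`
    [set x | A x -> forall y, A y -> `|h x - h y| <= e + K * l1dist x y].
  apply: (iffLR (compact_near_coveringP A)) => // x Ax.
  have e20 : 0 < e / 2 by rewrite divr_gt0.
  have /cvgrPdist_lt := iffLR (subspace_continuousP A h) ch x Ax.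
  move=> /(_ _ e20)/nbhs_ballP[r /= r0 hr].
  have r20 : 0 < r / 2 by rewrite divr_gt0.
  near=> x' K => Ax' y Ay /=.
  have xx' : ball x (r / 2) x' by near: x'; exact: nbhsx_ballx.
  have K0 : 0 <= K by near: K; exact: nbhs_pinfty_ge.
  have KM : M *+ 2 / (r / 2) <= K by near: K; exact: nbhs_pinfty_ge (num_real _).
  have [near_y|far_y] := ltP (l1dist x' y) (r / 2).
    have hx' : `|h x - h x'| < e / 2.
      by apply: hr => //; apply: le_ball xx'; rewrite ler_pdivrMr//; lra.
    have hy : `|h x - h y| < e / 2.
      apply: hr => //; rewrite [r]splitr.
      exact: ball_triangle xx' (l1dist_ball near_y).
    have := ler_distD (h x) (h x') (h y); rewrite (distrC (h x') (h x)).
    have := mulr_ge0 K0 (l1dist_ge0 x' y); lra.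
  have le2M : `|h x' - h y| <= M *+ 2.
    by rewrite mulr2n; apply: le_trans (ler_normB _ _) (lerD _ _); exact: hM.
  apply: le_trans le2M _.
  have : M *+ 2 <= K * l1dist x' y.
    rewrite ler_pdivrMr// in KM; apply: le_trans KM _.
    by rewrite ler_wpM2l.
  lra.
exists (`|K| + 1); first by rewrite addr_ge0.
move=> x y Ax Ay; apply: (hK (`|K| + 1)) => //.
by rewrite (le_lt_trans (ler_norm K))// ltrDl.
Unshelve. all: by end_near. Qed.

Lemma almost_lipschitz_continuous A h :
  almost_lipschitz A h -> {within A, continuous h}.
Proof.
move=> hK; apply/subspace_continuousP => x Ax.
apply/cvgrPdist_le => /= e e0.
have e20 : 0 < e / 2 by rewrite divr_gt0.
have [K K0 {}hK] := hK _ e20.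
have D0 : 0 < K *+ d + 1 :> R by rewrite ltr_wpDl// mulrn_wge0.
have r0 : 0 < e / 2 / (K *+ d + 1) by rewrite !divr_gt0.
apply: filterS (nbhsx_ballx x _ r0) => y /ball_l1dist xy Ay.
apply: le_trans (hK x y Ax Ay) _.
rewrite [leRHS]splitr lerD2l; apply: le_trans (ler_wpM2l K0 xy) _.
rewrite mulrnAr -mulrnAl mulrA ler_pdivrMr// mulrC ler_wpM2l//; lra.
Qed.

End AlmostLipschitz.

(** * Moving one coordinate *)

Section SetCoord.
Context (R : realType) (d : nat).
Implicit Types (x y t : 'rV[R]_d) (i j : 'I_d) (u v : R).

Lemma set_coord_same t i u : set_coord t i u 0 i = u.
Proof. by rewrite mxE eqxx. Qed.

Lemma set_coord_neq t i j u : j != i -> set_coord t i u 0 j = t 0 j.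
Proof. by rewrite mxE => /negPf ->. Qed.

Lemma set_coord_id t i : set_coord t i (t 0 i) = t.
Proof. by apply/rowP => j; rewrite mxE; case: eqP => // ->. Qed.

Lemma set_coord_set t i u v : set_coord (set_coord t i u) i v = set_coord t i v.
Proof. by apply/rowP => j; rewrite !mxE; case: eqP. Qed.

Lemma set_coordC t i j u v : i != j ->
  set_coord (set_coord t i u) j v = set_coord (set_coord t j v) i u.
Proof.
move=> ij; apply/rowP => k; rewrite !mxE.
by have [->|//] := eqVneq k j; rewrite eq_sym (negPf ij).
Qed.

Lemma l1dist_set_coord x y i u :
  l1dist (set_coord x i u) (set_coord y i u) <= l1dist x y.
Proof.
apply: ler_sum => j _; rewrite !mxE; case: eqP => // _.
by rewrite subrr normr0.
Qed.

Lemma l1dist_set_coord_same x i u v :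
  l1dist (set_coord x i u) (set_coord x i v) = `|u - v|.
Proof.
rewrite /l1dist (bigD1 i)//= !set_coord_same big1 ?addr0// => j ji.
by rewrite !set_coord_neq// subrr normr0.
Qed.

End SetCoord.

(** * Extending one coordinate after the other *)

(* Cuts are the functions of one coordinate here, not Dedekind cuts. *)
Local Notation cut := Defs.cut.

Section SequentialExtension.
Context (R : realType) (d : nat) (F : 'I_d -> set R).
Context (F_knots : forall i, knots (F i)).
Implicit Types (f g h : 'rV[R]_d -> R) (x y t : 'rV[R]_d) (i j : 'I_d).
Implicit Types (s : seq 'I_d) (eps : {ffun 'I_d -> bool}).

Definition extend_coords s f := foldr (extend_coord F) f s.

(** The domain on which [extend_coords s f] is determined by f on [box F]. *)
Definition partial_box s : set 'rV[R]_d :=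
  box (fun i => if i \in s then `[0, 1]%classic else F i).

Lemma partial_box_enum : partial_box (enum 'I_d) = cube.
Proof.
by congr box; apply/funext => i; rewrite mem_enum.
Qed.

Lemma cube_coord t i : cube t -> 0 <= t 0 i <= 1.
Proof. by move=> /(_ i); rewrite /= in_itv. Qed.

Lemma partial_box_sub_cube s : partial_box s `<=` cube.
Proof.
move=> t st i; have := st i; case: ifP => // _.
by have [_ sF _ _] := F_knots i; exact: sF.
Qed.

Lemma partial_box_set_coord s i t u : i \notin s ->
  partial_box (i :: s) t -> F i u -> partial_box s (set_coord t i u).
Proof.
move=> si st Fu j; rewrite mxE; have [->|ji] := eqVneq j i.
  by rewrite (negPf si).
by have := st j; rewrite in_cons (negPf ji).
Qed.

Lemma cube_set_coord t i u : cube t -> 0 <= u <= 1 -> cube (set_coord t i u).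
Proof.
move=> ct u01 j; rewrite mxE; case: eqP => _; last exact: ct.
by rewrite /= in_itv.
Qed.

(** Going from x to y, the coordinates other than i move first: both extensions
    then use the same weights, and the bound passes to the mean. Moving
    coordinate i last is the univariate estimate. *)
Lemma extend_coord_almost_lipschitz s i h : i \notin s ->
  almost_lipschitz (partial_box s) h ->
  almost_lipschitz (partial_box (i :: s)) (extend_coord F i h).
Proof.
move=> si hh e e0; have e30 : 0 < e / 3 by rewrite divr_gt0.
have [K K0 hK] := hh _ e30; exists (K *+ 2); first by rewrite mulrn_wge0.
move=> x y sx sy; rewrite /extend_coord.
have x01 := cube_coord i (partial_box_sub_cube sx).
have y01 := cube_coord i (partial_box_sub_cube sy).
have move_others : `|affine_ext (F i) (cut h i x) (x 0 i) -
    affine_ext (F i) (cut h i y) (x 0 i)| <= e / 3 + K * l1dist x y.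
  rewrite affine_extB// -[leRHS](affine_ext_const (F_knots i) _ (x 0 i)).
  apply: normr_affine_ext => // b; rewrite /Defs.cut.
  have Fu := nearest_knot (F_knots i) b x01.
  apply: le_trans (hK _ _ _ _) _; [exact: partial_box_set_coord..|].
  by rewrite lerD2l ler_wpM2l// l1dist_set_coord.
have move_i : `|affine_ext (F i) (cut h i y) (x 0 i) -
    affine_ext (F i) (cut h i y) (y 0 i)| <= (e / 3) *+ 2 + K * l1dist x y.
  apply: le_trans (affine_ext_dist (F_knots i) (ltW e30) K0 _ x01 y01) _.
    move=> u v Fu Fv; rewrite -(l1dist_set_coord_same y i u v).
    by apply: hK; exact: partial_box_set_coord.
  by rewrite lerD2l ler_wpM2l// le_coord_l1dist.
apply: le_trans (ler_distD _ _ _) _; apply: le_trans (lerD move_others move_i) _.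
lra.
Qed.

Lemma extend_coords_almost_lipschitz s f : uniq s ->
  almost_lipschitz (box F) f ->
  almost_lipschitz (partial_box s) (extend_coords s f).
Proof.
move=> + hf; elim: s => [|i s IH]//= /andP[si us].
exact: extend_coord_almost_lipschitz si (IH us).
Qed.

Lemma extend_coords_box s f t : box F t -> extend_coords s f t = f t.
Proof.
move=> Ft; elim: s => [|i s IH]//=; rewrite /extend_coord affine_ext_knot//.
by rewrite /Defs.cut set_coord_id.
Qed.

Lemma affine_onM (A : set R) (a : R) (h : R -> R) :
  affine_on A h -> affine_on A (fun u => a * h u).
Proof.
move=> [b [c hbc]]; exists (a * b), (a * c) => u Au; rewrite hbc//; ring.
Qed.

Lemma affine_onD (A : set R) (h k : R -> R) :
  affine_on A h -> affine_on A k -> affine_on A (fun u => h u + k u).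
Proof.
move=> [a [b hab]] [a' [b' kab]]; exists (a + a'), (b + b') => u Au.
rewrite hab// kab//; ring.
Qed.

(** Once the cut along i is affine, extending in another coordinate j keeps it
    so: the result is a combination of two such cuts, with weights that depend
    on coordinate j only. *)
Lemma extend_coords_affine s f i t (I : set R) : i \in s -> is_interval I ->
  I `<=` `[0, 1]%classic `\` F i -> affine_on I (cut (extend_coords s f) i t).
Proof.
move=> + itvI sI; elim: s t => [|j s IH]//= t; rewrite in_cons.
have [<- _|ij /= si] := eqVneq i j.
- have [a [b hab]] := affine_ext_affine_on (F_knots i)
    (cut (extend_coords s f) i t) itvI sI.
  exists a, b => u Iu; rewrite -hab// /Defs.cut /extend_coord set_coord_same.
  by congr affine_ext; apply/funext => v; rewrite /Defs.cut set_coord_set.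
- have -> : cut (extend_coord F j (extend_coords s f)) i t = fun u =>
      weight (F j) true (t 0 j) * cut (extend_coords s f) i
        (set_coord t j (nearest (F j) true (t 0 j))) u +
      weight (F j) false (t 0 j) * cut (extend_coords s f) i
        (set_coord t j (nearest (F j) false (t 0 j))) u.
    apply/funext => u; rewrite /Defs.cut /extend_coord affine_extE// big_bool /=.
    by rewrite set_coord_neq 1?eq_sym// /Defs.cut !(set_coordC _ _ _ ij).
  by apply: affine_onD; apply: affine_onM; exact: IH.
Qed.

Lemma cut_continuous g i t : {within cube, continuous g} -> cube t ->
  {within `[0, 1], continuous (cut g i t)}.
Proof.
move=> cg ct; apply/subspace_continuousP => u /=; rewrite in_itv /= => u01.
have cu := cube_set_coord i ct u01.
apply/cvgrPdist_lt => /= e e0.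
have /cvgrPdist_lt := iffLR (subspace_continuousP _ _) cg _ cu.
move=> /(_ _ e0)/nbhs_ballP[r /= r0 hr].
apply: filterS (nbhsx_ballx u _ r0) => v uv; rewrite /= in_itv /= => v01.
apply: hr; last exact: cube_set_coord.
split=> // k j; rewrite !mxE; case: eqP => _ //; exact: ballxx.
Qed.

Lemma extend_coord_multiaffine f g i t :
  multiaffine_extension F f g -> cube t -> extend_coord F i g t = g t.
Proof.
move=> [cg _ ag] ct; rewrite /extend_coord affine_gap_ext ?cube_coord//.
- by rewrite /Defs.cut set_coord_id.
- exact: cut_continuous.
- by move=> I itvI sI; exact: ag.
Qed.

(** Extending in coordinate i uses values at points where this coordinate is a
    knot, thus in the smaller partial box, where g is already known to be the
    extension; and g obeys the same interpolation rule. Applied to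
    a multiaffine extension this gives uniqueness, and applied to the sum over
    corners it gives the explicit formula. *)
Lemma extend_coords_fixed s f g t : uniq s ->
  (forall x, box F x -> g x = f x) ->
  (forall i x, cube x -> extend_coord F i g x = g x) ->
  partial_box s t -> extend_coords s f t = g t.
Proof.
move=> + gf g_fixed; elim: s t => [|i s IH] t /=; first by move=> _ /gf.
move=> /andP[si us] st; have ct := partial_box_sub_cube st.
rewrite -(g_fixed i _ ct); apply: affine_ext_eq => //; first exact: cube_coord.
by move=> u Fu; apply: IH => //; exact: partial_box_set_coord.
Qed.

Definition corner_sum f t : R :=
  \sum_(eps : {ffun 'I_d -> bool}) corner_weight F eps t * f (corner F eps t).

Lemma corner_weight_ge0 eps t : cube t -> 0 <= corner_weight F eps t.
Proof.
by move=> ct; apply: prodr_ge0 => j _; apply: weight_ge0 => //; exact: cube_coord.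
Qed.

Lemma sum_corner_weight t :
  \sum_(eps : {ffun 'I_d -> bool}) corner_weight F eps t = 1.
Proof.
rewrite /corner_weight -(bigA_distr_bigA (fun j b => weight (F j) b (t 0 j))).
by rewrite big1// => j _; exact: sum_weight.
Qed.

Definition set_sign eps i (b : bool) : {ffun 'I_d -> bool} :=
  [ffun j => if j == i then b else eps j].

(** Each sign vector arises twice as [set_sign eps i b]: from itself and from the
    vector with the opposite sign at i. *)
Lemma sum_set_sign (phi : {ffun 'I_d -> bool} -> R) i :
  \sum_(b : bool) \sum_eps 2^-1 * phi (set_sign eps i b) = \sum_eps phi eps.
Proof.
pose flip eps := set_sign eps i (~~ eps i).
have flipK : involutive flip.
  move=> eps; apply/ffunP => j; rewrite !ffunE eqxx.
  by case: eqP => // ->; rewrite negbK.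
rewrite exchange_big /=.
transitivity (\sum_eps (2^-1 * phi eps + 2^-1 * phi (flip eps))).
  apply: eq_bigr => eps _; rewrite big_bool /=.
  have same : set_sign eps i (eps i) = eps.
    by apply/ffunP => j; rewrite ffunE; case: eqP => // ->.
  by rewrite /flip; case: (eps i) same => /= ->; rewrite // addrC.
rewrite big_split /= -!mulr_sumr [X in _ + _ * X](reindex_inj (inv_inj flipK)) /=.
under [X in _ + _ * X]eq_bigr do rewrite flipK.
lra.
Qed.

Lemma corner_set_coord eps i t b : 0 <= t 0 i <= 1 ->
  corner F eps (set_coord t i (nearest (F i) b (t 0 i))) =
  corner F (set_sign eps i b) t.
Proof.
move=> t01; apply/rowP => j; rewrite !mxE ffunE; have [->|//] := eqVneq j i.
by rewrite nearest_id//; exact: nearest_knot.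
Qed.

(** After moving coordinate i to a knot, its own weight is 1/2 for either sign;
    the weight of t has been transferred to the factor in front. *)
Lemma corner_weight_set_coord eps i t b : 0 <= t 0 i <= 1 ->
  weight (F i) b (t 0 i) *
    corner_weight F eps (set_coord t i (nearest (F i) b (t 0 i))) =
  2^-1 * corner_weight F (set_sign eps i b) t.
Proof.
move=> t01; rewrite /corner_weight (bigD1 i)//= [in RHS](bigD1 i)//=.
rewrite set_coord_same (weight_knot _ (nearest_knot (F_knots i) b t01)).
rewrite ffunE eqxx mulrCA; congr (_ * (_ * _)).
by apply: eq_bigr => j ji; rewrite set_coord_neq// ffunE (negPf ji).
Qed.

Lemma extend_coord_corner_sum i f t : cube t ->
  extend_coord F i (corner_sum f) t = corner_sum f t.
Proof.
move=> ct; have t01 := cube_coord i ct.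
rewrite /extend_coord affine_extE// -[RHS](sum_set_sign _ i).
apply: eq_bigr => b _; rewrite mulr_sumr; apply: eq_bigr => eps _.
by rewrite mulrA corner_weight_set_coord// corner_set_coord// mulrA.
Qed.

Lemma corner_sum_box f t : box F t -> corner_sum f t = f t.
Proof.
move=> Ft; have cornerE eps : corner F eps t = t.
  by apply/rowP => j; rewrite mxE nearest_id//; exact: Ft.
rewrite /corner_sum; under eq_bigr do rewrite cornerE.
by rewrite -mulr_suml sum_corner_weight mul1r.
Qed.

End SequentialExtension.

Theorem proposition1 (R : realType) (d : nat) (F : 'I_d -> set R)
    (F_closed : forall i, closed (F i))
    (F_sub01 : forall i, F i `<=` `[0, 1]%classic)
    (F_0 : forall i, F i 0)
    (F_1 : forall i, F i 1)
    (f : 'rV[R]_d -> R)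
    (f_cont : {within box F, continuous f}) :
  exists g : 'rV[R]_d -> R,
    [/\ multiaffine_extension F f g,
        forall g' : 'rV[R]_d -> R, multiaffine_extension F f g' ->
          forall t, cube t -> g' t = g t,
        forall t, cube t -> g t = sequential_ext F f t,
        forall t, cube t ->
          g t = \sum_(eps : {ffun 'I_d -> bool})
                  corner_weight F eps t * f (corner F eps t)
      & forall t, cube t ->
          (forall eps : {ffun 'I_d -> bool}, 0 <= corner_weight F eps t) /\
          \sum_(eps : {ffun 'I_d -> bool}) corner_weight F eps t = 1].
Proof.
have F_knots i : knots (F i) by split.
have uI := enum_uniq 'I_d.
have compact_box : compact (box F).
  by apply: rV_compact => i; exact: knots_compact (F_knots i).
exists (extend_coords F (enum 'I_d) f); split=> //.
- split.
  + rewrite -(partial_box_enum F); apply: almost_lipschitz_continuous.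
    apply: extend_coords_almost_lipschitz => //.
    exact: continuous_almost_lipschitz.
  + by move=> t Ft; exact: extend_coords_box.
  + move=> i t _ I itvI sI; apply: extend_coords_affine => //.
    exact: mem_enum.
- move=> g' hg' t ct; apply/esym/extend_coords_fixed => //.
  + by case: hg'.
  + by move=> i x; exact: (@extend_coord_multiaffine _ _ _ F_knots f).
  + by rewrite partial_box_enum.
- move=> t ct; apply: (@extend_coords_fixed _ _ _ F_knots _ _ (corner_sum F f)) => //.
  + by move=> x; exact: corner_sum_box.
  + by move=> i x; exact: extend_coord_corner_sum.
  + by rewrite partial_box_enum.
- move=> t ct; split; last exact: sum_corner_weight.
  by move=> eps; exact: corner_weight_ge0.
Qed.
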